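(* Let $\Gamma$ be a class of topological spaces, let $D$ be a finite set of cardinality at least two, and assume $\mathtt{OGD}^{D}(\Gamma)$. Suppose that $X$ is a Hausdorff space in $\Gamma$ and $H$ is an open $D$-dimensional dihypergraph on $X$. Then either $\chi(H)\le\aleph_0$ or $\chi(H)\ge\mathrm{cov}(\mathcal{N})$.
   Context: Working in $\mathsf{ZFC}$. A $D$-dimensional dihypergraph on $X$ is a subset $H$ of $X^D$ containing no constant sequence; open means open in $X^D$ (the box and product topologies coincide as $D$ is finite). The chromatic number $\chi(H)$ is the least cardinal $\kappa$ for which there is a map from $X$ to a set of cardinality $\kappa$ that is non-constant along every element of $H$. A homomorphism from $R\subseteq W^{D}$ to $S\subseteq Z^{D}$ is a map $W\to Z$ sending, coordinatewise, elements of $R$ to elements of $S$. $\mathbb{H}_{D^{\mathbb{N}}}=\bigcup_{t\in D^{<\mathbb{N}}}\prod_{d\in D}\mathcal{N}_{t\cdot(d)}$ is a $D$-dimensional dihypergraph on $D^{\mathbb{N}}$ (product topology, $D$ discrete), where $D^{<\mathbb N}$ is the set of finite sequences from $D$, $\mathcal{N}_s=\{b\in D^{\mathbb{N}} : s\sqsubseteq b\}$, and $t\cdot(d)$ is $t$ followed by the single entry $d$. $\mathtt{OGD}^{D}(\Gamma)$ is the statement: for every $Z\in\Gamma$ and every box-open $D$-dimensional dihypergraph $G$ on $Z$ (open in the box topology on $Z^D$), either $\chi(G)\le\aleph_0$ or there is a continuous homomorphism from $\mathbb{H}_{D^{\mathbb{N}}}$ to $G$. $\mathcal{N}$ (without subscript)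 is the $\sigma$-ideal of Lebesgue null subsets of $[0,1]$, and $\mathrm{cov}(\mathcal{N})$ is the least cardinality of a family of null sets whose union is $[0,1]$. *)

(* Defs.v *)
From mathcomp Require Import all_boot all_order all_algebra.
From mathcomp Require Import all_classical all_reals all_analysis.

Set Implicit Arguments.
Unset Strict Implicit.
Unset Printing Implicit Defensive.

Local Open Scope classical_set_scope.
Local Open Scope card_scope.
Local Open Scope ring_scope.

(* Cardinals are represented by sets and compared with [#<=]; a "least cardinal
   such that ..." is a chosen set of least cardinality. *)

Lemma least_cardinality T (P : set (set T)) : P !=set0 ->
  exists A, P A /\ forall B, P B -> A #<= B.
Proof.
move=> [A0 PA0].
have [[B [PB B0]]|noempty] := pselect (exists B, P B /\ B = set0).
  by exists B; split => // C _; rewrite B0 card_ge0.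
have inh B : P B -> exists x, B x.
  move=> PB; apply: contrapT => nB; apply: noempty; exists B; split => //.
  by rewrite -subset0 => x Bx; apply: nB; exists x.
pose sys (S : set (set T -> T)) :=
  (forall f B, S f -> P B -> B (f B)) /\
  (forall f g B, S f -> S g -> P B -> f B = g B -> f = g).
have [|S [[S1 S2] Smax]] := @Zorn_bigcup _ sys.
  move=> F Fsys Ftot; split.
    by move=> f B [S FS Sf] PB; exact: ((Fsys S FS).1 f B Sf PB).
  move=> f g B [S FS Sf] [S' FS' S'g] PB fg.
  have [SS'|S'S] := Ftot S S' FS FS'.
    by exact: ((Fsys S' FS').2 f g B (SS' _ Sf) S'g PB fg).
  by exact: ((Fsys S FS).2 f g B Sf (S'S _ S'g) PB fg).
have [B0 [PB0 B0S]] : exists B, P B /\ B `<=` [set f B | f in S].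
  apply: contrapT => nocov.
  have miss B : exists y, P B -> B y /\ forall f, S f -> f B <> y.
    have [PB|nPB] := pselect (P B); last by have [x _] := inh _ PA0; exists x.
    apply: contrapT => nomiss; apply: nocov; exists B; split => // y By.
    apply: contrapT => ny; apply: nomiss; exists y => _; split => // f Sf fy.
    by apply: ny; exists f.
  have [g gP] := choice miss.
  apply: (Smax (S `|` [set g])).
    split=> [f Sf|SgS]; first by left.
    have Sg : S g by apply: SgS; right.
    exact: (gP _ PA0).2 Sg erefl.
  split=> [f B [Sf|->] PB|f h B [Sf|->] [Sh|->] PB // fh].
  - exact: (S1 f B Sf PB).
  - exact: (gP _ PB).1.
  - exact: (S2 f h B).
  - by have := (gP _ PB).2 _ Sf.
  - by have := (gP _ PB).2 _ Sh; rewrite fh.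
exists B0; split => // B PB.
apply: card_le_trans (subset_card_le B0S) _.
apply: card_le_trans (card_image_le _ _) _.
have injS : {in S &, injective (fun f : set T -> T => f B)}.
  by move=> f h /set_mem Sf /set_mem Sh fh; exact: (S2 _ _ B).
have := inj_card_eq injS; rewrite card_eq_le => /andP[_ SB].
apply: card_le_trans SB _; apply: subset_card_le => y [f Sf <-].
exact: (S1 f B Sf PB).
Qed.

Definition constant_seq (D Y : Type) (x : D -> Y) := exists y, forall d, x d = y.

Definition dihypergraph (D X : Type) (H : set (D -> X)) :=
  forall x, H x -> ~ constant_seq x.

Definition colorable (D X Y : Type) (H : set (D -> X)) (K : set Y) :=
  exists c : X -> Y, (forall x, K (c x)) /\
    forall x, H x -> ~ constant_seq (c \o x).

(* The least cardinality of a set of colors, over all types of colors.  As the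
   identity colors a dihypergraph on X, it is attained by a subset of X. *)
Definition chromatic_number (D X : Type) (H : set (D -> X)) : set X :=
  xget set0 [set A : set X | colorable H A /\
                 forall (Y : Type) (K : set Y), colorable H K -> A #<= K].

Lemma chromatic_numberP (D X : Type) (H : set (D -> X)) : dihypergraph H ->
  colorable H (chromatic_number H) /\
  forall (Y : Type) (K : set Y), colorable H K -> chromatic_number H #<= K.
Proof.
move=> dH; apply: (@xgetPex _ set0 [set A : set X | colorable H A /\
  forall (Y : Type) (K : set Y), colorable H K -> A #<= K]).
have [|A [HA Amin]] := @least_cardinality _ [set A : set X | colorable H A].
  by exists setT; exists id; split.
exists A; split => // Y K [c [cK cH]].
have [r rP] : exists r : X -> X,
    (forall x, c (r x) = c x) /\ (forall x y, c x = c y -> r x = r y).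
  have [s sP] : exists s : Y -> X -> X, forall y x, c x = y -> c (s y x) = y /\
      forall x', c x' = y -> s y x' = s y x.
    have /choice[s sP] : forall y : Y, exists t : X -> X,
        (forall x, c x = y -> c (t x) = y) /\ (forall x x', t x = t x')
        \/ forall x, c x <> y.
      move=> y; have [[x0 cx0]|ny] := pselect (exists x, c x = y).
        by exists (cst x0); left; split.
      by exists id; right => x cx; apply: ny; exists x.
    exists s => y x cx; case: (sP y) => [[s1 s2]|/(_ x)//].
    split; [exact: (s1 x cx)|by move=> x' _; exact: (s2 x' x)].
  exists (fun x => s (c x) x); split => [x|x y cxy]; first exact: (sP _ _ erefl).1.
  by rewrite cxy; apply: (sP (c y) y erefl).2.
have Hr : colorable H (range r).
  exists r; split => [x|x Hx [z rz]]; first by exists x.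
  by apply: (cH _ Hx); exists (c z) => d /=; rewrite -rP.1 [r _]rz.
apply: card_le_trans (Amin _ Hr) _.
have injc : {in range r &, injective c}.
  move=> _ _ /set_mem[x _ <-] /set_mem[y _ <-]; rewrite !rP.1.
  exact: rP.2.
have := inj_card_eq injc; rewrite card_eq_le => /andP[_ cr].
by apply: card_le_trans cr _; apply: subset_card_le => _ [x _ <-].
Qed.

Definition dihom (D W Z : Type) (R : set (D -> W)) (S : set (D -> Z))
  (f : W -> Z) := forall x, R x -> S (f \o x).

(* For infinite D this is finer than the topology of [prod_topology]. *)
Definition box_open (D : Type) (X : topologicalType) (H : set (D -> X)) :=
  forall x, H x -> exists U : D -> set X,
    (forall d, open (U d) /\ U d (x d)) /\
    (forall y, (forall d, U d (y d)) -> H y).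

Definition baire (D : choiceType) : topologicalType :=
  prod_topology (fun _ : nat => discrete_topology D).

Definition cylinder (D : choiceType) (s : seq D) : set (baire D) :=
  [set b | mkseq b (size s) = s].

Definition HDN (D : choiceType) : set (D -> baire D) :=
  [set b | exists t : seq D, forall d, cylinder (rcons t d) (b d)].

Arguments HDN : clear implicits.

Definition OGD (D : choiceType) (Gamma : topologicalType -> Prop) :=
  forall (Z : topologicalType), Gamma Z ->
  forall G : set (D -> Z), dihypergraph G -> box_open G ->
    chromatic_number G #<= [set: nat] \/
    exists f : baire D -> Z, continuous f /\ dihom (HDN D) G f.

Definition null_ideal (R : realType) : set (set R) :=
  [set A | A `<=` `[0, 1]%classic /\ (@lebesgue_measure R).-negligible A].

Arguments null_ideal : clear implicits.

Definition null_cover (R : realType) (F : set (set R)) :=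
  F `<=` null_ideal R /\ \bigcup_(A in F) A = `[0, 1]%classic.

Arguments null_cover : clear implicits.

Definition cov_null (R : realType) : set (set R) :=
  xget set0 [set F : set (set R) | null_cover R F /\
                 forall F', null_cover R F' -> F #<= F'].

Arguments cov_null : clear implicits.

Lemma cov_nullP (R : realType) : null_cover R (cov_null R) /\
  forall F, null_cover R F -> cov_null R #<= F.
Proof.
apply: (@xgetPex _ set0 [set F : set (set R) | null_cover R F /\
  forall F', null_cover R F' -> F #<= F']).
apply: (@least_cardinality _ [set F | null_cover R F]).
exists [set [set x] | x in `[0, 1]%classic]; split; last first.
  apply/seteqP; split => [x [_ [y y01 <-] ->]//|x x01].
  by exists [set x] => //; exists x.
move=> _ [x x01 <-]; split; first by move=> _ ->.
apply/negligibleP; first exact: measurable_set1.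
exact: lebesgue_measure_set1.
Qed.

(* Main.v *)
(** Along a continuous homomorphism from [HDN D] to [H], a colouring of [H] pulls
    back to a colouring of [HDN D].  A set containing no element of [HDN D] avoids,
    below each node of the tree of finite sequences, at least one child; read
    through base-[#|D|] expansions it therefore becomes a null subset of [0, 1].
    So the colour classes yield a cover of [0, 1] by null sets, indexed by the
    colours. *)

Require Import Defs.
From mathcomp Require Import all_boot all_order all_algebra.
From mathcomp Require Import all_classical all_reals all_analysis.
From mathcomp Require Import ring lra.

Import Order.TTheory GRing.Theory Num.Theory.

Set Implicit Arguments.
Unset Strict Implicit.
Unset Printing Implicit Defensive.

Local Open Scope classical_set_scope.
Local Open Scope card_scope.

Lemma open_box_open (D : choiceType) (X : topologicalType) (H : set (D -> X)) :
  open (H : set (prod_topology (fun _ : D => X))) -> box_open H.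
Proof.
move=> oH x Hx.
pose F : set_system (D -> X) := [set A | exists U : D -> set X,
  (forall d, open (U d) /\ U d (x d)) /\ (forall y, (forall d, U d (y d)) -> A y)].
(* Box neighbourhoods of [x] form a filter, which converges to [x] for the product
   topology since each coordinate does. *)
have FF : Filter F.
  split=> [|A B [U [U1 U2]] [V [V1 V2]]|A B AB [U [U1 U2]]].
  - by exists (fun=> setT); split=> // d; split=> //; exact: openT.
  - exists (fun d => U d `&` V d); split=> [d|y UVy].
      by split; [exact: openI (U1 d).1 (V1 d).1|split; [exact: (U1 d).2|exact: (V1 d).2]].
    by split; [apply: U2 => d; exact: (UVy d).1|apply: V2 => d; exact: (UVy d).2].
  - by exists U; split=> // y /U2; exact: AB.
have Fx : F --> (x : prod_topology (fun _ : D => X)).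
  apply/cvg_sup => i A /=.
  rewrite (@nbhsE (initial_topology (fun f : D -> X => f i))).
  move=> [_ [[C oC <-] Cx] CA].
  (* The box restricts only coordinate [i], to [C]; every other side is the whole space. *)
  exists (fun d => [set y | d = i -> C y]); split=> [d|y Cy]; last exact/CA/Cy.
  have [->|di] := eqVneq d i; last first.
    rewrite (_ : [set _ | _] = setT); first by split; [exact: openT|].
    by apply/seteqP; split=> // y _ /= E; rewrite E eqxx in di.
  rewrite (_ : [set _ | _] = C) //.
  by apply/seteqP; split=> y /=; [apply|].
by apply: Fx; exact: open_nbhs_nbhs.
Qed.

Definition independent (D X : Type) (H : set (D -> X)) (B : set X) :=
  forall x : D -> X, (forall d, B (x d)) -> ~ H x.

(** If [B] met every child of [t], one point chosen in each child would form an element of [HDN D]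
    inside [B]. *)
Lemma independent_HDN_cylinder (D : choiceType) (B : set (baire D)) (t : seq D) :
  independent (HDN D) B -> exists d, B `&` cylinder (rcons t d) = set0.
Proof.
move=> indB; apply: contrapT => no.
have /choice[b Bb] : forall d, exists b, (B `&` cylinder (rcons t d)) b.
  by move=> d; apply/set0P/eqP => B0; apply: no; exists d.
by apply: (indB b) => [d|]; [exact: (Bb d).1|exists t => d; exact: (Bb d).2].
Qed.

Section Expansion.
Variables (R : realType) (D : finType).
Hypothesis D2 : (2 <= #|D|)%N.
Local Open Scope ring_scope.

Let k : R := #|D|%:R.
Let mu := @lebesgue_measure R.

Let k_gt0 : 0 < k.
Proof. by rewrite ltr0n (leq_trans _ D2). Qed.

Lemma first_digit (x : R) : 0 <= x <= 1 ->
  exists d : D, 0 <= k * x - (enum_rank d)%:R <= 1.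
Proof.
move=> /andP[x0 x1].
have kx0 : 0 <= k * x by rewrite mulr_ge0 // ltW.
have [x_lt1|x_ge1] := ltP x 1.
  have /andP[lo hi] := truncn_itv kx0.
  have ltk : (Num.truncn (k * x) < #|D|)%N.
    by rewrite -(ltr_nat R) (le_lt_trans lo) // gtr_pMr.
  exists (enum_val (Ordinal ltk)); rewrite enum_valK /=.
  by rewrite -natr1 in hi; lra.
(* Truncation would give [k], which is not a digit; the last digit leaves remainder [1], still in
   the closed unit interval. *)
have {x0 x1 x_ge1} -> : x = 1 by lra.
have ltk : (#|D|.-1 < #|D|)%N by rewrite prednK // (leq_trans _ D2).
exists (enum_val (Ordinal ltk)); rewrite enum_valK /=.
have : k = #|D|.-1%:R + 1 by rewrite natr1 prednK // (leq_trans _ D2).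
by lra.
Qed.

(** The number [0.s] in base [k], by Horner's rule: the left end of the cell of points with an
    expansion beginning with [s]. *)
Definition left_end (s : seq D) : R :=
  foldr (fun d r => ((enum_rank d)%:R + r) / k) 0 s.

(* A point with two expansions gets one of them: the cells are closed intervals, so
   the choice does not matter and [1] needs no special treatment. *)
Lemma base_expansion : exists code : R -> baire D, forall x s,
  0 <= x <= 1 -> cylinder s (code x) ->
  left_end s <= x <= left_end s + k ^- size s.
Proof.
have /choice[dg dgP] : forall x : R, exists d : D,
    0 <= x <= 1 -> 0 <= k * x - (enum_rank d)%:R <= 1.
  move=> x; have [x01|//] := boolP (0 <= x <= 1).
    by have [d] := first_digit x01; exists d.
  have /card_gt0P[d _] : (0 < #|D|)%N by rewrite (leq_trans _ D2).
  by exists d.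
(* [T] deletes the first digit, so the [n]-th digit of [x] is the first digit of the [n]-th
   iterate. *)
pose T x := k * x - (enum_rank (dg x))%:R.
exists (fun x n => dg (iter n T x)) => x s.
rewrite /cylinder /=; elim: s x => [|d s IH] x x01.
  by rewrite expr0 invr1 add0r.
rewrite /mkseq /= => -[dgx].
rewrite (iotaDl 1 0) -map_comp => E.
have /IH : 0 <= T x <= 1 by exact: dgP.
have -> : mkseq (fun n => dg (iter n T (T x))) (size s) = s.
  by rewrite -[RHS]E; apply: eq_map => n /=; rewrite -iterS iterSr.
move=> /(_ erefl) /andP[lo hi].
have xE : x = ((enum_rank d)%:R + T x) / k.
  by rewrite /T dgx; field; rewrite gt_eqF.
rewrite xE /= -/(left_end s) exprS invfM [k^-1 * _]mulrC -mulrDl !ler_pM2r ?invr_gt0 //.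
by rewrite -addrA !lerD2l lo.
Qed.

(** [B] misses one child of [s]; covering the other [k - 1] children, each [k] times smaller, gains
    a factor [(k - 1) / k] per level. The covers are finite unions of cells, hence measurable even
    when the preimage of [B] is not. *)
Lemma independent_cover (code : R -> baire D) (B : set (baire D)) :
  (forall x s, 0 <= x <= 1 -> cylinder s (code x) ->
    left_end s <= x <= left_end s + k ^- size s) ->
  independent (HDN D) B -> forall n s, exists C : set R,
    [/\ measurable C,
        forall x, 0 <= x <= 1 -> B (code x) -> cylinder s (code x) -> C x &
        (mu C <= (((k - 1) / k) ^+ n * k ^- size s)%:E)%E].
Proof.
move=> codeP indB; elim=> [|n IH] s.
  exists `[left_end s, left_end s + k ^- size s]%classic; split=> //.
    by move=> x x01 _ sx /=; rewrite in_itv /=; exact: codeP.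
  rewrite /mu lebesgue_measure_itv /= lte_fin expr0 mul1r; case: ifP => _.
    by rewrite -EFinD lee_fin; lra.
  by rewrite lee_fin invr_ge0 exprn_ge0 // ltW.
have [d0 Bd0] := independent_HDN_cylinder s indB.
have /choice[C CP] := fun d => IH (rcons s d).
pose A := [set d | d != d0].
have mU : measurable (\bigcup_(d in A) C d).
  by apply: fin_bigcup_measurable => [|d _]; [exact: finite_finset|case: (CP d)].
exists (\bigcup_(d in A) C d); split=> //.
  move=> x x01 Bx sx.
  (* The digit of [x] after [s] cannot be [d0], because [B] misses that child. *)
  have sx' : cylinder (rcons s (code x (size s))) (code x).
    by rewrite /cylinder /= size_rcons mkseqS sx.
  exists (code x (size s)); last by have [_ + _] := CP (code x (size s)); apply.
  by apply/eqP => E; rewrite E in sx'; rewrite -[False]/(set0 (code x)) -Bd0.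
apply: le_trans (@content_sub_fsum _ _ _ mu _ A _ C _ _ mU _) _ => //.
- exact: finite_finset.
- by move=> d _; case: (CP d).
rewrite (fsbigE (enum (predC1 d0))) ?enum_uniq//; first last.
- by move=> d Ad; rewrite mem_enum inE Ad.
- by move=> d /=; rewrite mem_enum inE.
rewrite big_enum_cond /=.
apply: (@le_trans _ _ (\sum_(d in predC1 d0) (((k - 1) / k) ^+ n * k ^- (size s).+1)%:E)%E).
  rewrite [leLHS](eq_bigl (mem (predC1 d0))); last first.
    by move=> d; rewrite inE /= andb_idr // => dd0; rewrite mem_set.
  by apply: lee_sum => d _; have [_ _] := CP d; rewrite size_rcons.
(* There are [k - 1] equal terms, and their sum is exactly the required bound. *)
rewrite sumEFin lee_fin sumr_const cardC1 -mulr_natr.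
have -> : #|D|.-1%:R = k - 1 :> R.
  by rewrite /k -[in RHS](prednK (n := #|D|)) ?(leq_trans _ D2) // -natr1 addrK.
rewrite le_eqVlt; apply/orP; left; apply/eqP.
rewrite !exprS invfM; field.
by rewrite expf_neq0 gt_eqF.
Qed.

(** The depth-[n] covers from the root have measure at most [((k - 1) / k) ^+ n], which tends to
    [0], so their intersection is a null set. *)
Lemma independent_negligible (code : R -> baire D) (B : set (baire D)) :
  (forall x s, 0 <= x <= 1 -> cylinder s (code x) ->
    left_end s <= x <= left_end s + k ^- size s) ->
  independent (HDN D) B -> mu.-negligible (`[0, 1] `&` code @^-1` B).
Proof.
move=> codeP indB.
have /choice[C CP] := fun n => independent_cover codeP indB n [::].
have mC n : measurable (C n) by case: (CP n).
exists (\bigcap_n C n); split; first exact: bigcapT_measurable.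
  apply/eqP; rewrite eq_le measure_ge0 andbT.
  have r1 : `|(k - 1) / k| < 1.
    have k1 : 1 <= k by rewrite ler1n (leq_trans _ D2).
    by rewrite ger0_norm ?ltr_pdivrMr ?divr_ge0 ?subr_ge0 1?[0 <= k]ltW //; lra.
  apply/lee_addgt0Pr => e e0; rewrite add0e.
  have /cvgrPdist_le/(_ e e0)[n _ /(_ n (leqnn n))/=] := cvg_expr r1.
  rewrite sub0r normrN => /(le_trans (ler_norm _)) ne.
  have [_ _ Cn] := CP n; apply: le_trans (le_trans Cn _).
    apply: le_measure; rewrite ?inE; [exact: bigcapT_measurable|exact: mC|].
    by move=> y; apply.
  by rewrite lee_fin expr0 invr1 mulr1.
move=> x [/=]; rewrite in_itv /= => x01 Bx n _.
by have [_ + _] := CP n; apply.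
Qed.
End Expansion.

Theorem proposition6p8 (R : realType) (Gamma : topologicalType -> Prop)
    (D : finType) (hD : (2 <= #|D|)%N) (hOGD : OGD D Gamma)
    (X : topologicalType) (hausX : hausdorff_space X) (GammaX : Gamma X)
    (H : set (D -> X)) (dihypH : dihypergraph H)
    (openH : open (H : set (prod_topology (fun _ : D => X)))) :
  chromatic_number H #<= [set: nat] \/ cov_null R #<= chromatic_number H.
Proof.
have [|[f [_ fH]]] := hOGD X GammaX H dihypH (open_box_open openH); first by left.
right.
have [[c [cK cH]] _] := chromatic_numberP dihypH.
have [code codeP] := base_expansion R hD.
pose N a := `[(0 : R)%R, 1%R]%classic `&` code @^-1` [set b | c (f b) = a].
apply: card_le_trans (card_image_le N _).
apply: (cov_nullP R).2; split.
  move=> _ [a _ <-]; split; first by move=> x [].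
  (* An element of [HDN D] inside the class of [a] would be sent by [f] to an element of [H] on
     which [c] is constantly [a]. *)
  apply: independent_negligible hD _ _ codeP _ => b ba Hb.
  by apply: (cH _ (fH _ Hb)); exists a => d; exact: ba.
apply/seteqP; split=> [x [_ [a _ <-] [x01 _]] //|x x01].
by exists (N (c (f (code x)))) => //; exists (c (f (code x))).
Qed.
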